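(* Suppose $(X,d)$ is a locally compact bounded metric space, and $\mathcal{M}$ is a uniformly bounded in variation family of topological measures (respectively, of deficient topological measures) on $X$. Then $(\mathcal{M},d_{KR})$ is a complete metric space.
   Context: All spaces are Hausdorff. $\mathscr{O}(X),\mathscr{C}(X),\mathscr{K}(X)$ denote the open, closed, compact subsets of $X$; $\sqcup$ is disjoint union. For a locally compact space $X$, a topological measure on $X$ is a map $\mu:\mathscr{C}(X)\cup\mathscr{O}(X)\to[0,\infty]$, not identically $\infty$, such that: (TM1) if $A,B,A\sqcup B\in\mathscr{K}(X)\cup\mathscr{O}(X)$ then $\mu(A\sqcup B)=\mu(A)+\mu(B)$; (TM2) $\mu(U)=\sup\{\mu(K):K\in\mathscr{K}(X),K\subseteq U\}$ for $U\in\mathscr{O}(X)$; (TM3) $\mu(F)=\inf\{\mu(U):U\in\mathscr{O}(X),F\subseteq U\}$ for $F\in\mathscr{C}(X)$. If (TM1) is required only for compact $A,B$, $\mu$ is called a deficient topological measure. $\|\mu\|=\mu(X)$, and $\mu$ is finite if $\mu(X)<\infty$. A family $\mathcal{M}$ of finite (deficient) topological measures on $X$ is uniformly bounded in variation if there is a constant $M>0$ such that $\|\mu\|\le M$ for each $\mu\in\mathcal{M}$. $C(X)$ is the set of continuous real-valued functions on $X$; $C_0(X)$ is the set of $f\in C(X)$ with $\{|f|\ge\epsilon\}$ compact for all $\epsilon>0$; $C_c(X)$ is the set of continuous functions with compact support. Quasi-integral: for a finite deficient topological measure $\mu$ and $f\in C_0(X)$ with $f(X)\subseteq[a,b]$,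 $\int_X f\,d\mu=\int_a^b\mu(f^{-1}((t,\infty)))\,dt+a\,\mu(X)$ (independent of $[a,b]$). $Lip_1(X,d)=\{f\in C(X):|f(x)-f(y)|\le d(x,y)\ \forall x,y\in X\}$. For finite topological measures, $d_{KR}(\mu,\nu)=\sup\{|\int_X f\,d\mu-\int_X f\,d\nu|: f\in Lip_1(X,d)\cap C_c(X)\}$. For finite deficient topological measures, $d_{KR}$ is defined by the same formula, taking only nonnegative $f$.
   Formalization: Completeness is claimed for families M that are d_KR-closed among all (deficient) topological measures of norm ≤ the bound (δ_{1/n} on [0,1] shows the need); d_KR may be +∞ when X is compact and the total masses differ (it is then infinite), and is proved finite otherwise. *)

(* Defs.v *)
From HB Require Import structures.
From mathcomp Require Import all_boot all_order all_algebra.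
From mathcomp Require Import all_classical all_reals all_analysis.
Import Order.TTheory GRing.Theory Num.Theory.
Import numFieldNormedType.Exports.

Set Implicit Arguments.
Unset Strict Implicit.
Unset Printing Implicit Defensive.

Local Open Scope classical_set_scope.
Local Open Scope ring_scope.

Section topological_measures.
Context {R : realType} {X : topologicalType}.
Local Open Scope ereal_scope.

Definition additive_on (D : set (set X)) (mu : set X -> \bar R) : Prop :=
  forall A B : set X, D A -> D B -> D (A `|` B) -> A `&` B = set0 ->
    mu (A `|` B) = mu A + mu B.

(* A map defined on the open and the closed sets only is encoded as a function
   on all sets whose value elsewhere is the dummy 0 ([set_map_out]).  This makes
   Leibniz equality of encodings the same as equality of the maps. *)
Record regular_set_map (D : set (set X)) (mu : set X -> \bar R) : Prop := {
  set_map_out : forall A, ~ open A -> ~ closed A -> mu A = 0;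
  set_map_ge0 : forall A, 0 <= mu A;
  set_map_proper : exists2 A, open A \/ closed A & mu A != +oo;
  set_map_additive : additive_on D mu;
  set_map_open : forall U, open U ->
    mu U = ereal_sup [set mu K | K in [set K | compact K /\ K `<=` U]];
  set_map_closed : forall F, closed F ->
    mu F = ereal_inf [set mu U | U in [set U | open U /\ F `<=` U]]
}.

Definition topological_measure : set (set X -> \bar R) :=
  regular_set_map [set A | compact A \/ open A].

Definition deficient_topological_measure : set (set X -> \bar R) :=
  regular_set_map [set A | compact A].

Definition variation_ball (P : set (set X -> \bar R)) (C : R) :
    set (set X -> \bar R) :=
  [set mu | P mu /\ mu [set: X] <= C%:E].

(* The value does not depend on the interval [a, b] containing f(X); the one
   used here is [inf f(X), sup f(X)], for a bounded f. *)
Definition quasi_integral (mu : set X -> \bar R) (f : X -> R) : \bar R :=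
  let a := inf (range f) in
  let b := sup (range f) in
  \int[lebesgue_measure]_(t in `[a, b]) mu (f @^-1` `]t, +oo[)
    + a%:E * mu [set: X].

Definition Cc : set (X -> R) :=
  [set f | continuous f /\ compact (closure [set x | f x != 0%R])].

End topological_measures.

Section Kantorovich_Rubinstein.
Context {R : realType} {X : metricType R}.

Definition Lip1 : set (X -> R) :=
  [set f | continuous f /\ forall x y, `|f x - f y| <= mdist x y].

Definition dKR_over (T : set (X -> R)) (mu nu : set X -> \bar R) : \bar R :=
  ereal_sup [set `|quasi_integral mu f - quasi_integral nu f|%E | f in T].

Definition dKR := dKR_over (Lip1 `&` Cc).

Definition dKR_nonneg :=
  dKR_over (Lip1 `&` Cc `&` [set f | forall x, 0 <= f x]).

End Kantorovich_Rubinstein.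

Section extended_metrics.
Context {R : realType} {T : Type}.
Variables (d : T -> T -> \bar R) (M : set T).
Local Open Scope ereal_scope.

(* A metric whose values are allowed to be +oo. *)
Record extended_metric_on : Prop := {
  emetric_ge0 : forall x y, M x -> M y -> 0 <= d x y;
  emetric_eq0 : forall x y, M x -> M y -> (d x y = 0 <-> x = y);
  emetric_sym : forall x y, M x -> M y -> d x y = d y x;
  emetric_triangle : forall x y z, M x -> M y -> M z ->
    d x z <= d x y + d y z
}.

Definition emetric_cvg (u : nat -> T) (x : T) : Prop :=
  (fun n => d (u n) x) @ \oo --> 0.

Definition emetric_cauchy (u : nat -> T) : Prop :=
  forall eps : R, (0 < eps)%R ->
    exists N : nat, forall m n : nat, (N <= m)%N -> (N <= n)%N ->
      d (u m) (u n) < eps%:E.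

Definition emetric_complete : Prop :=
  forall u : nat -> T, (forall n, M (u n)) -> emetric_cauchy u ->
    exists2 x, M x & emetric_cvg u x.

Definition emetric_closed_in (B : set T) : Prop :=
  forall (u : nat -> T) (x : T),
    (forall n, M (u n)) -> B x -> emetric_cvg u x -> M x.

End extended_metrics.

(* [d] makes [M] a complete (extended) metric space of set maps on X.
   On a compact X every constant is a compactly supported 1-Lipschitz function,
   so the distance of two maps with different total masses is +oo; in all other
   cases the distance is finite.  In particular [d] is a metric in the usual
   sense as soon as X is not compact or the members of [M] have equal masses.
   Completeness is asserted when [M] is closed in the family [B]; the choice
   [M := B] is allowed. *)
Definition complete_metric_family {R : realType} {X : topologicalType}
    (d : (set X -> \bar R) -> (set X -> \bar R) -> \bar R)
    (B M : set (set X -> \bar R)) : Prop :=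
  [/\ extended_metric_on d M,
      forall mu nu, M mu -> M nu ->
        (compact [set: X] -> mu [set: X] = nu [set: X]) ->
        (d mu nu < +oo)%E
    & emetric_closed_in d M B -> emetric_complete d M].

(* Main.v *)
(* Write [phi_f t] for the mass of the superlevel set {f > t}.  If K is compact
   and U an open neighborhood of K, a truncated distance function to K is a
   compactly supported Lipschitz function comparing mu(V) with nu(U) for a
   neighborhood V of K: e * mu(V) <= e * nu(U) + d_KR(mu, nu).  Hence d_KR
   separates points, and along a Cauchy sequence
   lam(K) := inf_{U open, K <= U} limsup_n mu_n(U)
   does not change if limsup is replaced by liminf.  This makes lam additive on
   disjoint compact sets and outer regular, so that it extends to a deficient
   topological measure mu, and it makes phi_f of mu_n and of mu interlace
   asymptotically, so that the integrals of every admissible f converge.  The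
   Cauchy property then gives uniformity in f.
   For topological measures the additivity across an open and a compact set
   passes to mu by squeezing neighborhoods, and since the integral of f is the
   difference of those of its positive and negative parts, the two distances
   differ at most by a factor 2. *)
Require Import Defs.
From HB Require Import structures.
From mathcomp Require Import all_boot all_order all_algebra.
From mathcomp Require Import all_classical all_reals all_analysis.
From mathcomp Require Import measurable_realfun lra.
Import Order.TTheory GRing.Theory Num.Theory.
Import numFieldNormedType.Exports.
Local Open Scope classical_set_scope.
Local Open Scope ring_scope.

Set Implicit Arguments.
Unset Strict Implicit.
Unset Printing Implicit Defensive.

(** * Lipschitz bump functions *)

Section locally_compact_metric.
Context {R : realType} {X : metricType R}.
Implicit Types (K U V : set X) (f g : X -> R).

Lemma compact_closed_metric K : compact K -> closed K.
Proof. exact: compact_closed (@metric_hausdorff _ X). Qed.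

Lemma lipschitz_continuous f :
  (forall x y, `|f x - f y| <= mdist x y) -> continuous f.
Proof.
move=> lf x; apply/cvgrPdist_lt => e e0.
apply/nbhs_ballP; exists e => //= y.
by rewrite ballEmdist/= => /(le_lt_trans (lf x y)).
Qed.

Definition thickening K (e : R) : set X :=
  [set x | exists2 y, K y & mdist x y < e].

Lemma thickening_open K e : open (thickening K e).
Proof.
rewrite openE => x [y Ky xy]; apply/nbhs_ballP.
exists (e - mdist x y); first by rewrite /= subr_gt0.
move=> z; rewrite ballEmdist/= ltrBrDr => xz; exists y => //.
by rewrite (le_lt_trans (metric_triangle _ x _))// (metric_sym z).
Qed.

Lemma sub_thickening K e : 0 < e -> K `<=` thickening K e.
Proof. by move=> e0 x Kx; exists x => //; rewrite mdistxx. Qed.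

(** A Lebesgue number: half of a radius admissible at one point serves all nearby points, and
    compactness makes the choice uniform over [K]. *)
Lemma thickening_sub_open K U : compact K -> open U -> K `<=` U ->
  exists2 e : R, 0 < e & thickening K e `<=` U.
Proof.
move=> /compact_near_coveringP cK oU KU.
have : \forall e \near 0^'+, K `<=` (fun x => ball x e `<=` U).
  apply: (cK R 0^'+ (fun e x => ball x e `<=` U)) => x Kx.
  have /nbhs_ballP[r/= r0 xrU] : nbhs x U.
    by apply: open_nbhs_nbhs; split=> //; exact: KU.
  exists (ball x (r / 2), `]0, r / 2[%classic).
    split=> /=; first by apply: nbhsx_ballx; rewrite divr_gt0.
    exists (r / 2); rewrite /= ?divr_gt0// => t/=.
    rewrite sub0r normrN in_itv/= => tr t0.
    by rewrite t0 (le_lt_trans (ler_norm _)).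
  move=> [y t]/= [xy]; rewrite in_itv/= => /andP[_ tr] z yz.
  apply: xrU; rewrite [r]splitr; apply: ball_triangle xy _.
  by apply: le_ball yz; exact: ltW.
move=> [r/= r0 /(_ (r / 2))]; rewrite /= sub0r normrN gtr0_norm ?divr_gt0//.
rewrite ltr_pdivrMr// ltr_pMr// ltr1n => /(_ isT isT) KrU.
exists (r / 2); first by rewrite divr_gt0.
by move=> x [y Ky xy]; apply: (KrU y Ky); rewrite ballEmdist/= metric_sym.
Qed.

Lemma compact_sub_disjoint (A B : set X) : compact A -> compact B ->
  A `&` B = set0 -> exists U V, [/\ open U, open V, A `<=` U, B `<=` V &
    U `&` V = set0].
Proof.
move=> cA cB AB0.
have [e e0 AeB] : exists2 e : R, 0 < e & thickening A e `<=` ~` B.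
  apply: thickening_sub_open cA _ _; last exact/disjoints_subset.
  by apply: closed_openC; exact: compact_closed_metric.
have e20 : 0 < e / 2 by rewrite divr_gt0.
exists (thickening A (e / 2)), (thickening B (e / 2)).
split; [exact: thickening_open|exact: thickening_open| | |].
- exact: sub_thickening.
- exact: sub_thickening.
- rewrite -subset0 => x [[a Aa xa] [b Bb xb]].
  apply: (AeB b) Bb; exists a => //.
  rewrite (le_lt_trans (metric_triangle _ x _))// [e]splitr ltrD//.
  by rewrite metric_sym.
Qed.

Hypothesis X_lc : locally_compact [set: X].

Lemma open_compact_nbhs (x : X) U : open U -> U x ->
  exists D, [/\ compact D, nbhs x D & D `<=` U].
Proof.
move=> oU Ux.
have [D0 + [cD0 _]] := X_lc (x := x) I.
rewrite /within/= => xD0.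
have xU : nbhs x U by exact: open_nbhs_nbhs.
have [V xV VU] := @uniform_regular X x U xU.
exists (D0 `&` closure V); split.
- by apply: compact_closedI => //; exact: closed_closure.
- apply: filterI; first by apply: filterS xD0 => y; exact.
  by apply: filterS xV; exact: subset_closure.
- by move=> y [_ /VU].
Qed.

Lemma compact_sub_interior K U : compact K -> open U -> K `<=` U ->
  exists D, [/\ compact D, K `<=` D° & D `<=` U].
Proof.
move=> /compact_near_coveringP cK oU KU.
(* The compact subsets of [U] are directed under union, so eventually along [F] means for all sets
   containing some such compact set. The near-covering form of compactness then replaces a finite
   subcover. *)
pose F : set_system (set X) :=
  filter_from [set D | compact D /\ D `<=` U] (fun D => [set D' | D `<=` D']).
have FF : Filter F.
  apply: filter_from_filter; first by exists set0; split=> //; exact: compact0.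
  move=> D1 D2 [cD1 D1U] [cD2 D2U]; exists (D1 `|` D2).
    by split; [exact: compactU|rewrite subUset].
  by move=> D'/=; rewrite subUset.
have [|D [cD DU] /(_ D (@subset_refl _ _)) KD] := cK _ F (fun D x => D° x) FF.
  move=> x Kx; have [D [cD xD DU]] := open_compact_nbhs oU (KU _ Kx).
  exists (D°, [set D' | D `<=` D']).
    by split=> /=; [exact: nbhs_interior|exists D].
  by move=> [y D']/= [Dy DD']; apply: interiorS Dy.
by exists D.
Qed.

(** For nonempty [K] the bump is the positive part of the minimum of [e / 2] and [e - dist(x, K)],
    where the [e]-thickening of [K] lies inside a compact subset of [U]. The cut at [e / 2] creates
    a plateau on the [e / 2]-thickening, which serves as [V]. *)
Lemma lipschitz_urysohn K U : compact K -> open U -> K `<=` U ->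
  exists (e : R) g V,
    [/\ 0 < e, (Lip1 `&` Cc `&` [set f | forall x, 0 <= f x]) g,
      open V /\ K `<=` V, (forall x, V x -> g x = e) /\ (forall x, g x <= e) &
      forall x, g x != 0 -> U x].
Proof.
move=> cK oU KU.
have [D [cD KD DU]] := compact_sub_interior cK oU KU.
have [e e0 KeD] := thickening_sub_open cK (open_interior D) KD.
have e20 : 0 < e / 2 by rewrite divr_gt0.
pose h (x y : X) : R := Num.min (e / 2) (e - mdist x y).
(* Including [0] keeps the set nonempty when [K] is empty and makes the supremum nonnegative. *)
pose S (x : X) : set R := 0 |` [set h x y | y in K].
pose g x := sup (S x).
have Sub x : ubound (S x) (e / 2).
  by move=> _ [->|[y Ky <-]]; [exact: ltW|rewrite /h ge_min lexx].
have S0 x : S x !=set0 by exists 0; left.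
have Ssup x : has_sup (S x) by split=> //; exists (e / 2).
have gmin x : 0 <= g x by apply: ub_le_sup; [by case: (Ssup x)|left].
have gmax x : g x <= e / 2 by exact: ge_sup.
have hlip x x' y : h x y <= h x' y + mdist x x'.
  have := metric_triangle x' x y; rewrite (metric_sym x' x) => tri.
  have := mdist_ge0 x x'.
  rewrite /h; case: (leP (e / 2) (e - mdist x y)).
    by case: (leP (e / 2) (e - mdist x' y)); lra.
  by case: (leP (e / 2) (e - mdist x' y)); lra.
have glip1 x x' : g x <= g x' + mdist x x'.
  apply: ge_sup => // _ [->|[y Ky <-]]; first by rewrite addr_ge0// mdist_ge0.
  rewrite (le_trans (hlip x x' y))// lerD2r.
  by apply: ub_le_sup; [by case: (Ssup x')|right; exists y].
have glip x y : `|g x - g y| <= mdist x y.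
  have := glip1 x y; have := glip1 y x; rewrite (metric_sym y x) => yx xy.
  by rewrite ler_norml; apply/andP; split; lra.
have gU x : g x != 0 -> thickening K e x.
  apply: contra_neqP => xK; apply/eqP; rewrite eq_le gmin andbT.
  apply: ge_sup => // _ [->//|[y Ky <-]].
  rewrite /h ge_min subr_le0; apply/orP; right; rewrite leNgt; apply/negP => xy.
  by apply: xK; exists y.
have gc := lipschitz_continuous glip.
exists (e / 2), g, (thickening K (e / 2)); split => //.
- split=> //; split=> //; split=> //.
  apply: (subclosed_compact _ cD); first exact: closed_closure.
  have /closure_id -> := compact_closed_metric cD.
  by apply: closureS => x /gU/KeD /interior_subset.
- by split; [exact: thickening_open|exact: sub_thickening].
- split=> // x [y Ky xy]; apply/eqP; rewrite eq_le gmax/=.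
  have -> : e / 2 = h x y by rewrite /h min_l//; move: xy; lra.
  by apply: ub_le_sup; [by case: (Ssup x)|right; exists y].
- by move=> x /gU/KeD/interior_subset/DU.
Qed.

End locally_compact_metric.

(** * Deficient topological measures *)

Section deficient_topological_measures.
Context {R : realType} {X : metricType R}.
Implicit Types (A B K U V : set X) (mu nu : set X -> \bar R).
Local Open Scope ereal_scope.

Lemma topological_measure_deficient mu :
  topological_measure mu -> deficient_topological_measure mu.
Proof.
case=> out ge0 proper add op cl; split=> // A B cA cB cAB.
by apply: add; left.
Qed.

Lemma variation_ballW (C : R) :
  variation_ball (X := X) topological_measure C `<=`
  variation_ball deficient_topological_measure C.
Proof. by move=> mu [/topological_measure_deficient]. Qed.

Section one_measure.
Variable mu : set X -> \bar R.
Hypothesis mu_dtm : deficient_topological_measure mu.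

Let mu_ge0 A : 0 <= mu A. Proof. exact: set_map_ge0 mu_dtm A. Qed.

(** The smaller set is arbitrary because sets that are neither open nor closed carry the dummy value
    [0]. A closed [B] is reached through its open neighborhoods. *)
Lemma dtm_le A B : open B \/ closed B -> A `<=` B -> mu A <= mu B.
Proof.
have leO U V : open V -> U `<=` V -> mu U <= mu V.
  move=> oV UV; have [oU|noU] := pselect (open U).
    rewrite (set_map_open mu_dtm oU) (set_map_open mu_dtm oV).
    apply: ereal_sup_le => _ [K [cK KU] <-]; exists K => //; split=> //.
    exact: subset_trans UV.
  have [cU|ncU] := pselect (closed U).
    by rewrite (set_map_closed mu_dtm cU); apply: ereal_inf_lbound; exists V.
  by rewrite (set_map_out mu_dtm).
move=> [oB|cB] AB; first exact: leO.
rewrite (set_map_closed mu_dtm cB); apply: le_ereal_inf_tmp => _ [U [oU BU] <-].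
by apply: leO => //; exact: subset_trans BU.
Qed.

Lemma dtm_le_total A : mu A <= mu [set: X].
Proof. by apply: dtm_le => //; left; exact: openT. Qed.

Lemma dtm_inner U (x : \bar R) : open U ->
  (forall K, compact K -> K `<=` U -> mu K <= x) -> mu U <= x.
Proof.
move=> oU Ux; rewrite (set_map_open mu_dtm oU).
by apply: ge_ereal_sup => _ [K [cK KU] <-]; exact: Ux.
Qed.

Lemma dtm_outer F (x : \bar R) : closed F ->
  (forall U, open U -> F `<=` U -> x <= mu U) -> x <= mu F.
Proof.
move=> cF Fx; rewrite (set_map_closed mu_dtm cF).
by apply: le_ereal_inf_tmp => _ [U [oU FU] <-]; exact: Fx.
Qed.

Lemma dtm_set0 : mu [set: X] < +oo -> mu set0 = 0.
Proof.
move=> muX.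
have fin0 : mu set0 \is a fin_num.
  by rewrite ge0_fin_numE// (le_lt_trans (dtm_le_total _)).
have := @set_map_additive _ _ _ _ mu_dtm set0 set0.
rewrite /= setU0 setI0 => /(_ compact0 compact0 compact0 erefl).
move: fin0; case: (mu set0) => // r _ [] /eqP.
by rewrite eq_sym -subr_eq0 addrK => /eqP ->.
Qed.

(** A compact subset of the union splits into two compact pieces, each obtained by removing the
    other open set. Conversely, compact subsets of [U] and of [V] are disjoint and unite inside the
    union. *)
Lemma dtm_openU U V : mu [set: X] < +oo -> open U -> open V ->
  U `&` V = set0 -> mu (U `|` V) = mu U + mu V.
Proof.
move=> muX oU oV UV0; apply/eqP; rewrite eq_le; apply/andP; split.
  apply: dtm_inner => [|K cK KUV]; first exact: openU.
  have cKU : compact (K `&` ~` V).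
    by apply: compact_closedI => //; exact: open_closedC.
  have cKV : compact (K `&` ~` U).
    by apply: compact_closedI => //; exact: open_closedC.
  have KE : K = (K `&` ~` V) `|` (K `&` ~` U).
    by rewrite -setIUr -setCI setIC -(setIC U) UV0 setC0 setTI.
  rewrite {1}KE (set_map_additive mu_dtm)//=; last 2 first.
  - by rewrite -KE.
  - rewrite -subset0 => x [[Kx Vx] [_ Ux]].
    by have [] := KUV _ Kx.
  by apply: leeD; apply: dtm_le; [by left| |by left|] => x [/KUV[]].
have fin A : mu A \is a fin_num.
  by rewrite ge0_fin_numE// (le_lt_trans (dtm_le_total _)).
rewrite -leeBrDr//; apply: dtm_inner => // K cK KU.
rewrite leeBrDr// addeC -leeBrDr//; apply: dtm_inner => // L cL LV.
rewrite leeBrDr//.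
rewrite -(set_map_additive mu_dtm)//=.
- by apply: dtm_le; [left; exact: openU|rewrite setUC; exact: setUSS].
- exact: compactU.
- by rewrite -subset0 -UV0 setIC; exact: setISS.
Qed.

(** Reduces additivity across compact and open sets to one inequality. Its converse holds for every
    finite deficient topological measure by inner regularity. *)
Lemma topological_measureP : mu [set: X] < +oo ->
  (forall K U, compact K -> open U -> K `<=` U ->
    mu U <= mu K + mu (U `\` K)) ->
  topological_measure mu.
Proof.
move=> muX split_le.
have fin A : mu A \is a fin_num.
  by rewrite ge0_fin_numE// (le_lt_trans (dtm_le_total _)).
have oD U K : open U -> compact K -> open (U `\` K).
  move=> oU /compact_closed_metric cK.
  by rewrite setDE; apply: openI => //; exact: closed_openC.
have splitE K U : compact K -> open U -> K `<=` U -> mu U = mu K + mu (U `\` K).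
  move=> cK oU KU; apply/eqP; rewrite eq_le split_le//=.
  rewrite addeC -leeBrDr//; apply: dtm_inner; first exact: oD.
  move=> L cL LUK; rewrite leeBrDr// addeC -(set_map_additive mu_dtm)//=.
  - by apply: dtm_le; [left|rewrite subUset; split=> // x /LUK[]].
  - exact: compactU.
  - by rewrite -subset0 => x [Kx /LUK[]].
have mixed K V : compact K -> open V -> K `&` V = set0 ->
    compact (K `|` V) \/ open (K `|` V) -> mu (K `|` V) = mu K + mu V.
  move=> cK oV KV0.
  have KVK : (K `|` V) `\` K = V.
    rewrite setDUl setDv set0U; apply/setDidPl.
    by rewrite setIC.
  (* An open union is split directly. For a compact union, complements in the whole space are
     compared: the complement of [K] is the disjoint union of [V] and the complement of the union,
     both open. *)
  case=> [cKV|oKV]; last by rewrite (splitE K)// KVK.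
  have finD U L : compact L -> open U -> L `<=` U -> mu L = mu U - mu (U `\` L).
    by move=> cL oU LU; rewrite (splitE L U)// addeK.
  rewrite (finD [set: X] _ cKV openT (@subsetT _ _)).
  rewrite (splitE K [set: X])//; last exact: openT.
  have -> : [set: X] `\` K = V `|` ([set: X] `\` (K `|` V)).
    rewrite !setTD setCU setUIr setUv setIT setUC; apply/esym/setUidPl.
    by move=> x Vx Kx; rewrite -[False]/(set0 x) -KV0.
  rewrite dtm_openU//; last 2 first.
  - exact: oD openT cKV.
  - by rewrite -subset0 => x [Vx [_]]; apply; right.
  by rewrite addeA addeK.
case: mu_dtm => out _ proper add op cl; split=> // A B [cA|oA] [cB|oB] hAB AB0.
- by rewrite add//; exact: compactU.
- exact: mixed.
- by rewrite setUC mixed// 1?setIC// 1?addeC// setUC.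
- exact: dtm_openU.
Qed.

End one_measure.

(** Inner regularity turns the interlacing into equality on open sets, outer regularity carries it
    to closed sets, and elsewhere both maps take the dummy value. *)
Lemma dtm_eq mu nu : deficient_topological_measure mu ->
  deficient_topological_measure nu ->
  (forall K U, compact K -> open U -> K `<=` U -> mu K <= nu U) ->
  (forall K U, compact K -> open U -> K `<=` U -> nu K <= mu U) ->
  mu = nu.
Proof.
move=> mu_dtm nu_dtm munu numu.
have eqO U : open U -> mu U = nu U.
  move=> oU; apply/eqP; rewrite eq_le; apply/andP; split.
    by apply: (dtm_inner mu_dtm) => // K cK KU; exact: munu.
  by apply: (dtm_inner nu_dtm) => // K cK KU; exact: numu.
apply/funext => A; have [/eqO//|noA] := pselect (open A).
have [cA|ncA] := pselect (closed A); last first.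
  by rewrite (set_map_out mu_dtm)// (set_map_out nu_dtm).
apply/eqP; rewrite eq_le; apply/andP; split.
  apply: (dtm_outer nu_dtm) => // U oU AU; rewrite -eqO//.
  by apply: (dtm_le mu_dtm) => //; left.
apply: (dtm_outer mu_dtm) => // U oU AU; rewrite eqO//.
by apply: (dtm_le nu_dtm) => //; left.
Qed.

End deficient_topological_measures.

(** * Integrals of monotone functions *)

Section areas.
Context {R : realType}.
Implicit Types (p q : R -> R) (a b c h C : R).
Local Notation mu := (@lebesgue_measure R).

(** Half-open intervals tile a longer interval without overlap. *)
Definition area p a b : R := fine (\int[mu]_(t in `[a, b[) (p t)%:E)%E.

Definition bounded_profile C p :=
  measurable_fun [set: R] p /\ forall t, 0 <= p t <= C.

Let mp C p (D : set R) : bounded_profile C p -> measurable_fun D (fun t : R => (p t)%:E).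
Proof.
by move=> [mp _]; apply/measurable_EFinP; exact: measurable_funTS.
Qed.

Lemma nonincreasing_profile C p : {homo p : s t /~ s <= t} ->
  (forall t, 0 <= p t <= C) -> bounded_profile C p.
Proof.
move=> pni p0C; split=> //; apply: nonincreasing_measurable.
  exact: measurableT.
by move=> s t st; exact: pni.
Qed.

Lemma area_bounds C p a b (l u : R) : bounded_profile C p -> a <= b ->
  (forall t, a <= t -> t < b -> l <= p t <= u) ->
  [/\ (b - a) * l <= area p a b, area p a b <= (b - a) * u &
    (\int[mu]_(t in `[a, b[) (p t)%:E)%E = (area p a b)%:E].
Proof.
move=> Cp ab lpu.
have mab : measurable (`[a, b[%classic : set R) by exact: measurable_itv.
have lab : mu `[a, b[%classic = (b - a)%:E.
  rewrite lebesgue_measure_itv/= lte_fin; move: ab; rewrite le_eqVlt.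
  by case/orP=> [/eqP ->|->//]; rewrite ltxx subrr.
have int0 : (0 <= \int[mu]_(t in `[a, b[) (p t)%:E)%E.
  by apply: integral_ge0 => t _; rewrite lee_fin; case/andP: (Cp.2 t).
have up (v : R) : (forall t, a <= t -> t < b -> p t <= v) ->
    (\int[mu]_(t in `[a, b[) (p t)%:E <= (v * (b - a))%:E)%E.
  move=> pv; rewrite EFinM -lab -integral_cst//.
  apply: ge0_le_integral => //=.
  - by move=> t _; rewrite lee_fin; case/andP: (Cp.2 t).
  - exact: mp Cp.
  - by move=> t; rewrite in_itv/= lee_fin => /andP[]; exact: pv.
have fin : (\int[mu]_(t in `[a, b[) (p t)%:E)%E = (area p a b)%:E.
  rewrite /area fineK// ge0_fin_numE//.
  apply: le_lt_trans (ltry (C * (b - a))%R); apply: up => t _ _.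
  by case/andP: (Cp.2 t).
split=> //; last first.
  rewrite -lee_fin -fin mulrC; apply: up => t ta tb.
  by case/andP: (lpu t ta tb).
rewrite -lee_fin -fin mulrC.
(* Integrals are compared for nonnegative functions only, so a negative lower bound is handled by
   the nonnegativity of the integral. *)
have [l0|l0] := ltP l 0.
  apply: le_trans int0; rewrite lee_fin.
  by rewrite nmulr_rle0// subr_ge0.
rewrite EFinM -lab -integral_cst//.
apply: ge0_le_integral => //=.
- exact: mp Cp.
- move=> t; rewrite in_itv/= lee_fin => /andP[ta tb].
  by case/andP: (lpu t ta tb).
Qed.

Lemma area_fin C p a b : bounded_profile C p -> a <= b ->
  (\int[mu]_(t in `[a, b[) (p t)%:E)%E = (area p a b)%:E.
Proof.
move=> Cp ab; have [|_ _] := area_bounds (l := 0) (u := C) Cp ab => //.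
by move=> t _ _; exact: Cp.2.
Qed.

Lemma area_ge C p a b (l : R) : bounded_profile C p -> a <= b ->
  (forall t, a <= t -> t < b -> l <= p t) -> (b - a) * l <= area p a b.
Proof.
move=> Cp ab lp; have [|+ _ _] := area_bounds (l := l) (u := C) Cp ab => //.
by move=> t ta tb; rewrite lp//=; case/andP: (Cp.2 t).
Qed.

Lemma area_le C p a b (u : R) : bounded_profile C p -> a <= b ->
  (forall t, a <= t -> t < b -> p t <= u) -> area p a b <= (b - a) * u.
Proof.
move=> Cp ab pu; have [|_ + _] := area_bounds (l := 0) (u := u) Cp ab => //.
by move=> t ta tb; rewrite pu// andbT; case/andP: (Cp.2 t).
Qed.

Lemma area_ge0 C p a b : bounded_profile C p -> a <= b -> 0 <= area p a b.
Proof.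
move=> Cp ab; have := area_ge (l := 0) Cp ab; rewrite mulr0; apply => t _ _.
by case/andP: (Cp.2 t).
Qed.

Lemma eq_area p q a b : (forall t, a <= t -> t < b -> p t = q t) ->
  area p a b = area q a b.
Proof.
move=> pq; congr fine; apply: eq_integral => t; rewrite inE/= in_itv/=.
by move=> /andP[ta tb]; rewrite pq.
Qed.

Lemma area_cat C p a b c : bounded_profile C p -> a <= b -> b <= c ->
  area p a c = area p a b + area p b c.
Proof.
move=> Cp ab bc; have ac := le_trans ab bc.
apply: EFin_inj; rewrite EFinD -!(area_fin Cp)//.
have -> : `[a, c[%classic = `[a, b[%classic `|` `[b, c[%classic :> set R.
  apply/seteqP; split=> t /=; rewrite !in_itv/=.
    by move=> /andP[-> ->]; rewrite andbT /=; case: (ltP t b); [left|right].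
  case=> /andP[ta tb]; first by rewrite ta (lt_le_trans tb).
  by rewrite (le_trans ab ta).
rewrite ge0_integral_setU//=.
- exact: mp Cp.
- by move=> t _; rewrite lee_fin; case/andP: (Cp.2 t).
- apply/disj_setPS => t []/=; rewrite !in_itv/= => /andP[_ tb] /andP[].
  by rewrite leNgt tb.
Qed.

Lemma areaD C D p q a b : bounded_profile C p -> bounded_profile D q -> a <= b ->
  area (p \+ q) a b = area p a b + area q a b.
Proof.
move=> Cp Dq ab.
have CDpq : bounded_profile (C + D) (p \+ q).
  split; first exact: measurable_funD Cp.1 Dq.1.
  move=> t /=; case/andP: (Cp.2 t) => ? ?; case/andP: (Dq.2 t) => ? ?.
  by rewrite addr_ge0// lerD.
apply: EFin_inj; rewrite EFinD -(area_fin CDpq)// -(area_fin Cp)// -(area_fin Dq)//.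
rewrite -ge0_integralD//=.
- by move=> t _; rewrite lee_fin; case/andP: (Cp.2 t).
- exact: mp Cp.
- by move=> t _; rewrite lee_fin; case/andP: (Dq.2 t).
- exact: mp Dq.
Qed.

Lemma area_opp C p b : bounded_profile C p -> 0 <= b ->
  area p (- b) 0 = area (p \o -%R) 0 b.
Proof.
move=> Cp b0; congr fine.
have mpo (D : set R) : measurable D -> measurable_fun D (fun t => (p (- t))%:E).
  move=> mD; apply/measurable_EFinP.
  apply: (measurableT_comp Cp.1).
  exact: measurable_funTS.
(* Reflection exchanges which endpoint is included. Single points are null, so the endpoints are
   adjusted before Lebesgue measure is transported along negation. *)
transitivity (\int[mu]_(t in `]0%R, b]) (p (- t))%:E)%E; last first.
  rewrite -(@integral_itv_obnd_cbnd _ _ (BLeft b))//=; last first.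
    by apply: mpo; exact: measurable_itv.
  by rewrite -[LHS]integral_itv_bndo_bndc//; apply: mpo; exact: measurable_itv.
rewrite (_ : `]0%R, b]%classic =
  (-%R : _ -> measurableTypeR R) @^-1` `[- b, 0%R[); last first.
  apply/seteqP; split=> t /=; rewrite !in_itv/= lerN2 oppr_lt0; by case/andP=> -> ->.
transitivity (\int[pushforward mu (-%R : _ -> measurableTypeR R)]_(t in
    `[(- b)%R, 0%R[) (p t)%:E)%E; last first.
  rewrite ge0_integral_pushforward//=.
  - exact: mp Cp.
  - by move=> t _; rewrite lee_fin; case/andP: (Cp.2 t).
by apply: eq_measure_integral => //= A mA AS; exact/esym/lebesgue_measureN.
Qed.

(* Each cell of a grid of mesh [h] contributes to the left side at most what
   the cell two steps before it contributes to the right side. *)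
Lemma area_le_shift C p q h N (d : R) : 0 < h ->
  {homo p : s t /~ s <= t} -> {homo q : s t /~ s <= t} ->
  (forall t, 0 <= p t <= C) -> (forall t, 0 <= q t <= C) -> 0 <= d ->
  (forall i, (i < N)%N -> p (i.+1%:R * h) <= q (i%:R * h) + d) ->
  area p 0 (N%:R * h) <= area q 0 (N%:R * h) + 2 * h * C + N%:R * h * d.
Proof.
move=> h0 np nq pC qC d0 pq.
have Cp := nonincreasing_profile np pC.
have Cq := nonincreasing_profile nq qC.
have nh0 n : 0 <= n%:R * h by rewrite mulr_ge0// ltW.
have nhS n : n.+1%:R * h = n%:R * h + h by rewrite -natr1 mulrDl mul1r.
have C0 : 0 <= C by case/andP: (pC 0) => ? /(le_trans _); apply.
have cell n : (n.+2 < N)%N ->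
    area p (n.+2%:R * h) (n.+3%:R * h) <= area q (n%:R * h) (n.+1%:R * h) + h * d.
  move=> nN.
  have A : area p (n.+2%:R * h) (n.+3%:R * h) <= h * (q (n.+1%:R * h) + d).
    rewrite (le_trans (area_le (u := q (n.+1%:R * h) + d) Cp _ _))//.
    - by rewrite !nhS; lra.
    - by move=> t nt _; rewrite (le_trans _ (pq n.+1 (ltnW nN)))//; exact: np.
    - by rewrite !nhS; lra.
  have B : h * q (n.+1%:R * h) <= area q (n%:R * h) (n.+1%:R * h).
    rewrite (le_trans _ (area_ge (l := q (n.+1%:R * h)) Cq _ _))//.
    - by rewrite !nhS; lra.
    - by rewrite !nhS; lra.
    - by move=> t _ /ltW tn; exact: nq.
  by move: A B; lra.
(* The first two cells of [p] have no partner and are left to the term [2 * h * C]. *)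
have cells n : (n.+2 <= N)%N ->
    area p (2 * h) (n.+2%:R * h) <= area q 0 (n%:R * h) + n%:R * h * d.
  elim: n => [_|n IH nN].
    rewrite !mul0r addr0 (le_trans (area_le (u := C) Cp _ _))//.
      by move=> t _ _; case/andP: (pC t).
    by rewrite subrr mul0r; exact: area_ge0 Cq _.
  have n2 := nh0 n.
  rewrite (area_cat (b := n.+2%:R * h) Cp); [|by rewrite !nhS; lra|by rewrite !nhS; lra].
  rewrite (area_cat (b := n%:R * h) Cq) ?nh0//; last by rewrite nhS; lra.
  by have := IH (ltnW nN); have := cell n nN; rewrite (nhS n); lra.
have [N2|N2] := ltnP N 2.
  have q0 : 0 <= area q 0 (N%:R * h).
    exact: area_ge0 Cq _.
  have NC : area p 0 (N%:R * h) <= N%:R * h * C.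
    rewrite (le_trans (area_le (u := C) Cp _ _))//; last by rewrite subr0.
    by move=> t _ _; case/andP: (pC t).
  have : N%:R * h * C <= 2 * h * C.
    by rewrite -!mulrA ler_wpM2r ?ler_nat ?(ltnW N2)// mulr_ge0// ltW.
  have : 0 <= N%:R * h * d by rewrite mulr_ge0.
  by move: q0 NC; lra.
have [n NE] : exists n, N = n.+2 by case: N N2 {pq cell cells} => [|[|n]]// _; exists n.
have n2 := nh0 n.
rewrite NE (area_cat (b := 2 * h) Cp); [|by rewrite mulr_ge0 ?ltW|by rewrite !nhS; lra].
rewrite (area_cat (b := n%:R * h) Cq) ?nh0//; last by rewrite !nhS; lra.
have H1 : area p 0 (2 * h) <= 2 * h * C.
  have h20 : 0 <= 2 * h by rewrite mulr_ge0 ?ltW.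
  rewrite -[2 * h in leRHS]subr0; apply: area_le Cp h20 _ => t _ _.
  by case/andP: (pC t).
have H2 : 0 <= area q (n%:R * h) (n.+2%:R * h).
  by apply: area_ge0 Cq _; rewrite !nhS; lra.
have := cells n; rewrite NE leqnn => /(_ isT).
have : 0 <= 2 * h * d by rewrite mulr_ge0// mulr_ge0// ltW.
by move: H1 H2; rewrite !nhS; lra.
Qed.

(** A fixed grid needs only finitely many comparisons, which hold simultaneously for large [n].
    Comparing only levels [s < t] costs a shift that a fine mesh absorbs. *)
Lemma area_le_near C (p q : nat -> R -> R) (b : R) : 0 < b ->
  (forall n, {homo p n : s t /~ s <= t}) ->
  (forall n, {homo q n : s t /~ s <= t}) ->
  (forall n t, 0 <= p n t <= C) -> (forall n t, 0 <= q n t <= C) ->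
  (forall s t e, 0 <= s -> s < t -> 0 < e ->
    \forall n \near \oo, p n t <= q n s + e) ->
  forall e, 0 < e ->
    \forall n \near \oo, area (p n) 0 b <= area (q n) 0 b + e.
Proof.
move=> b0 np nq pC qC pq e e0.
(* More than [4 * b * C / e] cells make the error [2 * h * C] at most [e / 2]; the tolerance [d]
   below uses the other half. *)
pose M := (Num.truncn (4 * b * C / e)).+1.
have M0 : (0 : R) < M%:R by rewrite ltr0n.
pose h := b / M%:R; have h0 : 0 < h by rewrite divr_gt0.
have Mh : M%:R * h = b by rewrite /h mulrCA divff ?mulr1// gt_eqF.
have hC : 2 * h * C <= e / 2.
  have : 4 * b * C / e < M%:R by exact: truncnS_gt.
  rewrite ltr_pdivrMr// -Mh => /ltW.
  rewrite (_ : 4 * (M%:R * h) * C = M%:R * (4 * h * C)); last by lra.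
  by rewrite ler_pM2l//; lra.
pose d := e / 2 / b; have d0 : 0 < d by rewrite !divr_gt0.
have bd : b * d = e / 2 by rewrite /d mulrCA divff ?mulr1// gt_eqF.
have : \forall n \near \oo, forall i : 'I_M,
    p n (i.+1%:R * h) <= q n (i%:R * h) + d.
  apply: filter_forall => i; apply: pq => //; first by rewrite mulr_ge0// ltW.
  by rewrite ltr_pM2r// ltr_nat.
apply: filterS => n pqn.
have := area_le_shift h0 (np n) (nq n) (pC n) (qC n) (ltW d0) (N := M)
  (fun i iM => pqn (Ordinal iM)).
by rewrite Mh bd; lra.
Qed.

(** The case of constant sequences: the gap between [s] and [t] disappears after integration. *)
Lemma area_le_of_lt C p q (b : R) : 0 < b ->
  {homo p : s t /~ s <= t} -> {homo q : s t /~ s <= t} ->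
  (forall t, 0 <= p t <= C) -> (forall t, 0 <= q t <= C) ->
  (forall s t, 0 <= s -> s < t -> p t <= q s) -> area p 0 b <= area q 0 b.
Proof.
move=> b0 np nq pC qC pq; apply/ler_addgt0Pr => e e0.
have [|N _ /(_ N (leqnn N))//] := @area_le_near C (fun=> p) (fun=> q) b b0
  (fun=> np) (fun=> nq) (fun=> pC) (fun=> qC) _ e e0.
move=> s t d s0 st d0; apply: nearW => _.
by rewrite (le_trans (pq _ _ s0 st))// lerDl ltW.
Qed.

End areas.

(** * Quasi-integrals *)

Section quasi_integrals.
Context {R : realType} {X : metricType R}.
Implicit Types (f g : X -> R) (A U V : set X) (mu nu : set X -> \bar R) (B C : R).

Definition mass mu A : R := fine (mu A).

Definition profile mu f (t : R) : R := mass mu (f @^-1` `]t, +oo[).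

Definition qint mu f : R := fine (quasi_integral mu f).

Lemma open_superlevel f (t : R) : continuous f -> open (f @^-1` `]t, +oo[).
Proof. by move=> /continuousP; apply; exact: interval_open. Qed.

Section one_measure.
Variables (C : R) (mu : set X -> \bar R).
Hypothesis mu_ball : variation_ball deficient_topological_measure C mu.
Let mu_dtm := mu_ball.1.

Lemma ball_fin_num A : mu A \is a fin_num.
Proof.
rewrite ge0_fin_numE ?(set_map_ge0 mu_dtm)//.
exact: le_lt_trans (le_trans (dtm_le_total mu_dtm A) mu_ball.2) (ltry _).
Qed.

Lemma ball_finite : (mu [set: X] < +oo)%E.
Proof. exact: le_lt_trans mu_ball.2 (ltry _). Qed.

Lemma massE A : mu A = (mass mu A)%:E.
Proof. by rewrite fineK// ball_fin_num. Qed.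

Lemma mass_ge0 A : 0 <= mass mu A.
Proof. by rewrite fine_ge0// (set_map_ge0 mu_dtm). Qed.

Lemma mass_le A (B : set X) : open B \/ closed B -> A `<=` B -> mass mu A <= mass mu B.
Proof. by move=> oB AB; rewrite -lee_fin -!massE (dtm_le mu_dtm). Qed.

Lemma mass_bound A : mass mu A <= C.
Proof.
rewrite -lee_fin -massE; exact: le_trans (dtm_le_total mu_dtm A) mu_ball.2.
Qed.

Lemma mass0 : mass mu set0 = 0.
Proof. by rewrite /mass (dtm_set0 mu_dtm ball_finite). Qed.

Lemma profile_bounds f t : 0 <= profile mu f t <= C.
Proof. by rewrite mass_ge0 mass_bound. Qed.

Section continuous_function.
Variable f : X -> R.
Hypothesis cf : continuous f.

Lemma profile_nonincreasing : {homo profile mu f : s t /~ s <= t}.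
Proof.
move=> s t ts; apply: mass_le; first by left; exact: open_superlevel.
by move=> x /=; rewrite !in_itv/= !andbT; exact: le_lt_trans.
Qed.

Lemma profileP : bounded_profile C (profile mu f).
Proof. exact: nonincreasing_profile profile_nonincreasing (profile_bounds f). Qed.

(** Enlarging the interval adds zero above the supremum of [f] and full mass below its infimum, and
    the latter is offset by the change in the constant term. *)
Lemma quasi_integralE B : 0 <= B -> (forall x, `|f x| <= B) ->
  quasi_integral mu f =
  (area (profile mu f) (- B) B - B * mass mu [set: X])%:E.
Proof.
move=> B0 fB; rewrite /quasi_integral.
set a := inf _; set b := sup _; set m := mass mu setT.
have [Ba ab bB lo hi] : [/\ - B <= a, a <= b, b <= B,
    (forall t, t < a -> profile mu f t = m) &
    (forall t, b <= t -> profile mu f t = 0)].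
  (* On an empty space the infimum and the supremum of the range default to [0] and all masses
     vanish. *)
  have [[x0 _]|noX] := pselect (exists x : X, True); last first.
    have X0 A : A = set0 :> set X.
      by apply/seteqP; split=> // x; case: noX; exists x.
    have r0 : range f = set0 by rewrite (X0 setT) image_set0.
    have p0 t : profile mu f t = 0 by rewrite /profile (X0 (_ @^-1` _)) mass0.
    by rewrite /a /b /m r0 inf0 sup0 (X0 setT) mass0 oppr_le0; split.
  have r0 : range f !=set0 by exists (f x0), x0.
  have hlb : has_lbound (range f).
    by exists (- B) => _ [x _ <-]; move: (fB x); rewrite ler_norml => /andP[].
  have hub : has_ubound (range f).
    by exists B => _ [x _ <-]; move: (fB x); rewrite ler_norml => /andP[].
  have af x : a <= f x by apply: ge_inf => //; exists x.
  have fb x : f x <= b by apply: ub_le_sup => //; exists x.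
  split.
  - by apply: lb_le_inf => // _ [x _ <-]; move: (fB x); rewrite ler_norml => /andP[].
  - exact: le_trans (af x0) (fb x0).
  - by apply: ge_sup => // _ [x _ <-]; move: (fB x); rewrite ler_norml => /andP[].
  - move=> t ta; congr (mass mu _); apply/seteqP; split=> // x _ /=.
    by rewrite in_itv/= andbT (lt_le_trans ta).
  - move=> t bt; rewrite -mass0; congr (mass mu _); rewrite -subset0 => x /=.
    by rewrite in_itv/= andbT ltNge (le_trans (fb x)).
have -> : (\int[lebesgue_measure]_(t in `[a, b]) mu (f @^-1` `]t, +oo[) =
    (area (profile mu f) a b)%:E)%E.
  rewrite -(area_fin profileP ab) integral_itv_bndo_bndc; last first.
    apply/measurable_EFinP.
    exact: measurable_funTS profileP.1.
  by apply: eq_integral => t _; rewrite massE.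
rewrite massE -EFinM -EFinD; congr EFin.
rewrite (area_cat profileP Ba (le_trans ab bB)) (area_cat profileP ab bB).
have -> : area (profile mu f) b B = 0.
  apply/eqP; rewrite eq_le (area_ge0 profileP)// andbT.
  rewrite -[leRHS](mulr0 (B - b)); apply: area_le profileP _ _ => // t bt _.
  by rewrite hi.
have -> : area (profile mu f) (- B) a = (a - - B) * m.
  apply/eqP; rewrite eq_le; apply/andP; split.
    by apply: area_le profileP _ _ => // t _ ta; rewrite lo.
  by apply: area_ge profileP _ _ => // t _ ta; rewrite lo.
by rewrite -/m; lra.
Qed.

Lemma qintE B : 0 <= B -> (forall x, `|f x| <= B) ->
  qint mu f = area (profile mu f) (- B) B - B * mass mu [set: X].
Proof. by move=> B0 fB; rewrite /qint (quasi_integralE B0 fB). Qed.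

(** At negative levels the profile is the total mass, which cancels the constant term. *)
Lemma qint_ge0E B : 0 <= B -> (forall x, 0 <= f x <= B) ->
  qint mu f = area (profile mu f) 0 B.
Proof.
move=> B0 fB; rewrite (qintE B0); last first.
  by move=> x; case/andP: (fB x) => f0 fx; rewrite ger0_norm.
have NB : - B <= 0 by rewrite oppr_le0.
rewrite (area_cat profileP NB B0).
suff -> : area (profile mu f) (- B) 0 = (0 - - B) * mass mu setT by lra.
have E t : t < 0 -> profile mu f t = mass mu setT.
  move=> t0; congr (mass mu _); apply/seteqP; split=> // x _ /=.
  by rewrite in_itv/= andbT (lt_le_trans t0)//; case/andP: (fB x).
apply/eqP; rewrite eq_le; apply/andP; split.
  by apply: area_le profileP _ _ => // t _ t0; rewrite E.
by apply: area_ge profileP _ _ => // t _ t0; rewrite E.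
Qed.

(** A form of Markov's inequality: each superlevel set of level [t] with [0 <= t < e] contains
    [V]. *)
Lemma qint_ge e V : 0 <= e -> (forall x, 0 <= f x <= e) ->
  (forall x, V x -> f x = e) -> e * mass mu V <= qint mu f.
Proof.
move=> e0 fe Ve; rewrite (qint_ge0E e0 fe) -[e in leLHS]subr0.
apply: area_ge profileP _ _ => // t t0 te; apply: mass_le.
  by left; exact: open_superlevel.
by move=> x Vx /=; rewrite in_itv/= andbT Ve.
Qed.

Lemma qint_le e U : 0 <= e -> (forall x, 0 <= f x <= e) -> open U ->
  (forall x, f x != 0 -> U x) -> qint mu f <= e * mass mu U.
Proof.
move=> e0 fe oU fU; rewrite (qint_ge0E e0 fe) -[e in leRHS]subr0.
apply: area_le profileP _ _ => // t t0 te; apply: mass_le; first by left.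
move=> x /=; rewrite in_itv/= andbT => tx; apply: fU.
by rewrite gt_eqF// (le_lt_trans t0).
Qed.

End continuous_function.
End one_measure.
End quasi_integrals.

(** * The distance *)

Section Kantorovich_Rubinstein_distance.
Context {R : realType} {X : metricType R}.
Implicit Types (f g : X -> R) (U V : set X) (mu nu rho : set X -> \bar R).
Implicit Types (T : set (X -> R)).

Hypothesis X_bounded : exists D : R, forall x y : X, mdist x y <= D.

Definition Lip1_ge0 : set (X -> R) :=
  Lip1 `&` Cc `&` [set f | forall x, 0 <= f x].

Lemma Lip1_bound f : Lip1 f -> exists2 B : R, 0 < B & forall x, `|f x| <= B.
Proof.
move=> [_ lf]; have [D XD] := X_bounded.
have [[x0 _]|noX] := pselect (exists x : X, True); last first.
  by exists 1 => // x; case: noX; exists x.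
have D0 : 0 <= D := le_trans (mdist_ge0 x0 x0) (XD _ _).
exists (`|f x0| + D + 1); first by have := normr_ge0 (f x0); lra.
move=> x; have := XD x x0; have := lf x x0.
by have := ler_normD (f x - f x0) (f x0); rewrite subrK; lra.
Qed.

Lemma Lip1_ge0_bound f : Lip1_ge0 f ->
  exists2 B : R, 0 < B & forall x, 0 <= f x <= B.
Proof.
move=> [[/Lip1_bound[B B0 fB] _] f0]; exists B => // x.
by rewrite f0 (le_trans (ler_norm _)).
Qed.

Definition posfun f : X -> R := fun x => Num.max 0 (f x).

Lemma Lip1_ge0_posfun f : (Lip1 `&` Cc) f -> Lip1_ge0 (posfun f).
Proof.
move=> [[_ lf] [_ cf]].
have lp x y : `|posfun f x - posfun f y| <= mdist x y.
  apply: le_trans (lf x y); have := ler_norm (f x - f y).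
  have := ler_norm (- (f x - f y)); rewrite normrN => ? ?.
  have := normr_ge0 (f x - f y).
  rewrite /posfun ler_norml; case: (leP 0 (f x)) => ?; case: (leP 0 (f y)) => ? ?;
    by apply/andP; split; lra.
split; last by move=> x; rewrite /= /posfun le_max lexx.
have cp := lipschitz_continuous lp.
split=> //; split=> //; apply: subclosed_compact cf _; first exact: closed_closure.
apply: closureS => x /=; rewrite /posfun; apply: contra_neq => ->.
exact: maxxx.
Qed.

Lemma Lip1_CcN f : (Lip1 `&` Cc) f -> (Lip1 `&` Cc) (fun x => - f x).
Proof.
move=> [[ctf lf] [_ cf]].
have lp (x y : X) : `|- f x - - f y| <= mdist x y.
  by rewrite -opprD normrN.
have cp := lipschitz_continuous lp.
split; split=> //.
by rewrite (_ : [set x | - f x != 0] = [set x | f x != 0])//; apply/seteqP; split=> x /=;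
  rewrite oppr_eq0.
Qed.

(** Makes the suprema defining both distances range over nonempty sets, hence nonnegative. *)
Lemma Lip1_Cc_cst0 : Lip1_ge0 (fun=> 0).
Proof.
have l0 (x y : X) : `|(0 : R) - 0| <= mdist x y by rewrite subrr normr0 mdist_ge0.
have c0 := lipschitz_continuous l0.
split=> //; split=> //; split=> //.
rewrite (_ : [set x | _] = set0); first by rewrite closure0; exact: compact0.
by apply/seteqP; split=> x //=; rewrite eqxx.
Qed.

(* Fails for deficient topological measures: it needs additivity across the
   compact set {f <= - t} and the open set {f > - t}, for t > 0. *)
Lemma qint_signed C mu f : variation_ball topological_measure C mu ->
  (Lip1 `&` Cc) f ->
  qint mu f = qint mu (posfun f) - qint mu (posfun (fun x => - f x)).
Proof.
move=> muT Tf; have muD := variation_ballW muT.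
have [B B0 fB] := Lip1_bound Tf.1.
have pT := Lip1_ge0_posfun Tf; have nT := Lip1_ge0_posfun (Lip1_CcN Tf).
have cf := Tf.1.1; have cp := pT.1.1.1; have cn := nT.1.1.1.
have B0' := ltW B0.
have pB x : 0 <= posfun f x <= B.
  by rewrite pT.2 /posfun ge_max B0' (le_trans (ler_norm _)).
have nB x : 0 <= posfun (fun x => - f x) x <= B.
  by rewrite nT.2 /posfun ge_max B0' (le_trans (ler_norm _))// normrN.
rewrite (qintE muD cf B0' fB) (qint_ge0E muD cp B0' pB) (qint_ge0E muD cn B0' nB).
have NB0 : - B <= 0 by rewrite oppr_le0.
rewrite (area_cat (profileP muD cf) NB0 B0').
have -> : area (profile mu f) 0 B = area (profile mu (posfun f)) 0 B.
  apply: eq_area => t t0 _; congr (mass mu _); apply/seteqP.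
  by split=> x /=; rewrite !in_itv/= !andbT /posfun lt_max ltNge t0.
rewrite (area_opp (profileP muD cf) B0').
set m := mass mu setT; set p := profile mu f \o -%R.
set q := profile mu (posfun (fun x => - f x)).
(* For [t > 0], [r t] is the mass of the compact set {f <= - t} and [q t] that of the open set {f <
   - t}. The two functions interlace, so their areas agree. *)
pose r t := m - p t.
have mle t : 0 <= p t <= m.
  by rewrite (mass_ge0 muD) (mass_le muD)//; left; exact: openT.
have nr : {homo r : s t /~ s <= t}.
  move=> s t ts; rewrite lerD2l lerN2; apply: (profile_nonincreasing muD cf).
  by rewrite lerN2.
have mC : m <= C := mass_bound muD _.
have rC t : 0 <= r t <= C by have := mle t; rewrite /r; lra.
have nq : {homo q : s t /~ s <= t} := profile_nonincreasing muD cn.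
have qC t : 0 <= q t <= C := profile_bounds muD _ t.
have cpt t : 0 < t -> compact (f @^-1` `]-oo, - t]).
  move=> t0; apply: subclosed_compact Tf.2.2 _.
    by apply: preimage_closed => [x _|]; [exact: cf|exact: interval_closed].
  move=> x /=; rewrite in_itv/= => fx; apply: subset_closure => /=.
  by rewrite lt_eqF// (le_lt_trans fx)// oppr_lt0.
have rE t : 0 < t -> r t = mass mu (f @^-1` `]-oo, - t]).
  move=> t0; rewrite /r /m /p /= /profile.
  have TE : [set: X] = (f @^-1` `]-oo, - t]) `|` (f @^-1` `]- t, +oo[).
    apply/seteqP; split=> // x _ /=; rewrite !in_itv/= andbT.
    by case: (leP (f x) (- t)); [left|right].
  have : mu setT =
      (mu (f @^-1` `]-oo, (- t)%R]) + mu (f @^-1` `](- t)%R, +oo[))%E.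
    rewrite {1}TE; apply: (set_map_additive muT.1).
    - by left; exact: cpt.
    - by right; exact: open_superlevel.
    - by right; rewrite -TE; exact: openT.
    - rewrite -subset0 => x [] /=; rewrite !in_itv/= andbT => xt.
      by rewrite ltNge xt.
  by rewrite !(massE muD) => -[->]; rewrite addrK.
have -> : area q 0 B = area r 0 B.
  apply/eqP; rewrite eq_le; apply/andP; split; apply: (@area_le_of_lt _ C) => //.
    move=> s t s0 st; have t0 := le_lt_trans s0 st.
    rewrite (le_trans _ (nr _ _ (ltW st)))// rE//.
    apply: (mass_le muD); first by right; exact: compact_closed_metric (cpt _ t0).
    move=> x /=; rewrite !in_itv/= andbT /posfun lt_max ltNge ltW//=.
    by rewrite lerNr => /ltW.
  move=> s t s0 st; have t0 := le_lt_trans s0 st; rewrite rE//.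
  apply: (mass_le muD); first by left; exact: open_superlevel.
  move=> x /=; rewrite !in_itv/= andbT /posfun lt_max lerNr => tx.
  by rewrite (lt_le_trans st tx) orbT.
have -> : area p 0 B = B * m - area r 0 B.
  have pP : bounded_profile C p.
    split.
      apply: (measurableT_comp (profileP muD cf).1); exact: measurable_funTS.
    by move=> t; exact: profile_bounds muD f (- t).
  have rP := nonincreasing_profile nr rC.
  have <- : area (p \+ r) 0 B = B * m.
    have E : forall t, 0 <= t -> t < B -> (p \+ r) t = cst m t.
      by move=> t _ _; rewrite /= /r; lra.
    rewrite (eq_area E).
    have mP : bounded_profile C (cst m).
      by split; [exact: measurable_cst|move=> t; have := mle 0; rewrite /cst; lra].
    have := area_le (u := m) mP B0' (fun _ _ _ => lexx _).
    have := area_ge (l := m) mP B0' (fun _ _ _ => lexx _).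
    by rewrite subr0; lra.
  by rewrite (areaD pP rP B0'); lra.
by lra.
Qed.

(** * Metric axioms and finiteness of the distance on a ball *)

Section one_ball.
Variable C : R.
Notation ball := (variation_ball deficient_topological_measure C).

Lemma quasi_integral_qint mu f : ball mu -> Lip1 f ->
  quasi_integral mu f = (qint mu f)%:E.
Proof.
move=> bmu Lf; have [B B0 fB] := Lip1_bound Lf.
by rewrite /qint (quasi_integralE bmu Lf.1 (ltW B0) fB).
Qed.

Lemma dKR_overP T mu nu (d : R) : T `<=` Lip1 -> ball mu -> ball nu ->
  (dKR_over T mu nu <= d%:E)%E <->
  forall f, T f -> `|qint mu f - qint nu f| <= d.
Proof.
move=> TL bmu bnu; split=> [Td f Tf|Td].
  rewrite -lee_fin; apply: le_trans Td; apply: ereal_sup_ubound; exists f => //.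
  by rewrite !quasi_integral_qint//; exact: TL.
apply: ge_ereal_sup => _ [f Tf <-].
rewrite !quasi_integral_qint//; try exact: TL.
by rewrite -EFinB/= lee_fin; exact: Td.
Qed.

Lemma dKR_over_ge0 T mu nu : T !=set0 -> (0 <= dKR_over T mu nu)%E.
Proof. by move=> [f Tf]; apply: le_ereal_sup_tmp; eexists; [exists f|]. Qed.

Lemma dKR_over_sym T mu nu : T `<=` Lip1 -> ball mu -> ball nu ->
  dKR_over T mu nu = dKR_over T nu mu.
Proof.
move=> TL bmu bnu; congr ereal_sup; apply/seteqP; split=> _ [f Tf <-];
  exists f => //; rewrite !quasi_integral_qint//; try exact: TL.
  by rewrite -!EFinB/= distrC.
by rewrite -!EFinB/= distrC.
Qed.

Lemma dKR_over_triangle T mu nu rho : T `<=` Lip1 ->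
  ball mu -> ball nu -> ball rho ->
  (dKR_over T mu rho <= dKR_over T mu nu + dKR_over T nu rho)%E.
Proof.
move=> TL bmu bnu brho; apply: ge_ereal_sup => _ [f Tf <-].
apply: (@le_trans _ _ (`|quasi_integral mu f - quasi_integral nu f| +
    `|quasi_integral nu f - quasi_integral rho f|)%E).
  rewrite !quasi_integral_qint//; try exact: TL.
  by rewrite -!EFinB/= -EFinD lee_fin ler_distD.
by apply: leeD; apply: ereal_sup_ubound; exists f.
Qed.

Lemma dKR_over_refl T mu : T !=set0 -> T `<=` Lip1 -> ball mu ->
  dKR_over T mu mu = 0%E.
Proof.
move=> T0 TL bmu; apply/eqP; rewrite eq_le dKR_over_ge0// andbT.
by apply/(dKR_overP _ TL bmu bmu) => f _; rewrite subrr normr0.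
Qed.

Lemma dKR_nonneg_le_dKR mu nu : (dKR_nonneg mu nu <= dKR mu nu)%E.
Proof. by apply: ereal_sup_le => _ [f [Tf _] <-]; exists f. Qed.

(** A test function with a zero is bounded by the diameter bound [D], so its integrals are at most
    [D * C]. A test function without zeros forces [X] to be compact, and then the equal total masses
    cancel its unbounded constant part. *)
Lemma dKR_nonneg_finite mu nu : ball mu -> ball nu ->
  (compact [set: X] -> mu [set: X] = nu [set: X]) ->
  (dKR_nonneg mu nu < +oo)%E.
Proof.
move=> bmu bnu cmn; have [D0 XD0] := X_bounded.
(* On an empty space the given bound may be negative. *)
pose D := Num.max 0 D0.
have Dge0 : 0 <= D by rewrite le_max lexx.
have XD (x y : X) : mdist x y <= D by rewrite le_max XD0 orbT.
have C0 : 0 <= C := le_trans (mass_ge0 bmu setT) (mass_bound bmu _).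
have DC0 : 0 <= D * C by rewrite mulr_ge0.
apply: le_lt_trans (ltry (2 * D * C)).
apply/(dKR_overP _ _ bmu bnu); first by move=> f [[]].
move=> f Tf; have [[[cf lf] [_ ccf]] f0] := Tf.
have small : (forall x, f x <= D) -> `|qint mu f - qint nu f| <= 2 * D * C.
  move=> fD; have fD' x : 0 <= f x <= D by rewrite f0 fD.
  have Q rho : ball rho -> 0 <= qint rho f <= D * C.
    move=> br; apply/andP; split.
      have := qint_ge br cf (e := D) (V := set0) Dge0 fD' (fun x => False_ind _).
      by apply: le_trans; rewrite mulr_ge0// (mass_ge0 br).
    apply: le_trans (qint_le br cf Dge0 fD' openT (fun _ _ => I)) _.
    by rewrite ler_wpM2l// (mass_bound br).
  have := Q _ bmu; have := Q _ bnu; move=> /andP[? ?] /andP[? ?].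
  by rewrite ler_norml; apply/andP; split; lra.
have [[x0 fx0]|nz] := pselect (exists x0, f x0 = 0).
  apply: small => x; rewrite -[f x]subr0 -fx0 (le_trans (ler_norm _))//.
  exact: le_trans (lf _ _) (XD _ _).
have cX : compact [set: X].
  suff E : closure [set x | f x != 0] = setT by rewrite -E.
  apply/seteqP; split=> // x _; apply: subset_closure => /=.
  by apply/eqP => fx; apply: nz; exists x.
have mE : mass mu setT = mass nu setT by rewrite /mass cmn.
have [[x0 _]|noX] := pselect (exists x : X, True); last first.
  by apply: small => x; case: noX; exists x.
pose B := `|f x0| + D.
have fx x : `|f x - f x0| <= D := le_trans (lf _ _) (XD _ _).
have fB x : `|f x| <= B.
  by rewrite -[f x](subrK (f x0)) (le_trans (ler_normD _ _))// addrC lerD2l.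
have B0 : 0 <= B by rewrite addr_ge0.
rewrite (qintE bmu cf B0 fB) (qintE bnu cf B0 fB) mE.
have := ler_norm (f x0); have := ler_norm (- f x0); rewrite normrN => n1 n2.
have lo : - B <= f x0 - D by rewrite /B; lra.
have mid : f x0 - D <= f x0 + D by lra.
have hi : f x0 + D <= B by rewrite /B; lra.
(* All values of [f] lie within [D] of [f x0]. Below that window the profile is the total mass,
   common to both measures, and above it is zero; only the window of length [2 * D] can differ. *)
have S rho : ball rho ->
    [/\ area (profile rho f) (- B) B = area (profile rho f) (- B) (f x0 - D) +
      area (profile rho f) (f x0 - D) (f x0 + D),
      area (profile rho f) (- B) (f x0 - D) = (f x0 - D - - B) * mass rho setT &
      0 <= area (profile rho f) (f x0 - D) (f x0 + D) <= 2 * D * C].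
  move=> br; have P := profileP br cf.
  have x_lo t x : t < f x0 - D -> t < f x.
    by have := fx x; rewrite ler_norml => /andP[]; lra.
  have x_hi t x : f x0 + D <= t -> f x <= t.
    by have := fx x; rewrite ler_norml => /andP[]; lra.
  have p_lo t : t < f x0 - D -> profile rho f t = mass rho setT.
    move=> t0; congr (mass rho _); apply/seteqP; split=> // x _ /=.
    by rewrite in_itv/= andbT x_lo.
  have p_hi t : f x0 + D <= t -> profile rho f t = 0.
    move=> t0; rewrite -(mass0 br); congr (mass rho _); rewrite -subset0 => x /=.
    by rewrite in_itv/= andbT ltNge x_hi.
  split.
  - rewrite (area_cat P lo (le_trans mid hi)) (area_cat P mid hi).
    have -> : area (profile rho f) (f x0 + D) B = 0; last by rewrite addr0.
    apply/eqP; rewrite eq_le (area_ge0 P)// andbT.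
    rewrite -[leRHS](mulr0 (B - (f x0 + D))); apply: area_le P _ _ => // t bt _.
    by rewrite p_hi.
  - apply/eqP; rewrite eq_le; apply/andP; split.
      by apply: area_le P _ _ => // t _ ta; rewrite p_lo.
    by apply: area_ge P _ _ => // t _ ta; rewrite p_lo.
  - rewrite (area_ge0 P)//= (le_trans (area_le (u := C) P mid _))//.
      by move=> t _ _; case/andP: (profile_bounds br f t).
    by rewrite ler_wpM2r//; lra.
have [-> -> /andP[? ?]] := S _ bmu; have [-> -> /andP[? ?]] := S _ bnu.
by rewrite mE ler_norml; apply/andP; split; lra.
Qed.

End one_ball.

(** Positive and negative parts of a test function are admissible for [dKR_nonneg]. This transfers
    finiteness and convergence from [dKR_nonneg] to [dKR]. *)
Lemma dKR_le_dKR_nonneg C mu nu :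
  variation_ball topological_measure C mu ->
  variation_ball topological_measure C nu ->
  (dKR mu nu <= dKR_nonneg mu nu + dKR_nonneg mu nu)%E.
Proof.
move=> tmu tnu; have bmu := variation_ballW tmu; have bnu := variation_ballW tnu.
apply: ge_ereal_sup => _ [f Tf <-].
pose nf x : R := - f x.
have pT := Lip1_ge0_posfun Tf.
have nT : Lip1_ge0 (posfun nf) := Lip1_ge0_posfun (Lip1_CcN Tf).
apply: (@le_trans _ _
  (`|quasi_integral mu (posfun f) - quasi_integral nu (posfun f)| +
   `|quasi_integral mu (posfun nf) -
      quasi_integral nu (posfun nf)|)%E).
  rewrite !(quasi_integral_qint bmu) ?(quasi_integral_qint bnu);
    try exact: Tf.1; try exact: pT.1.1; try exact: nT.1.1.
  rewrite -!EFinB/= -EFinD lee_fin (qint_signed tmu Tf) (qint_signed tnu Tf).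
  set a := qint mu _; set b := qint mu _; set a' := qint nu _; set b' := qint nu _.
  by rewrite (_ : a - b - (a' - b') = (a - a') - (b - b')) ?ler_normB//; lra.
by apply: leeD; apply: ereal_sup_ubound; [exists (posfun f)|exists (posfun nf)].
Qed.

End Kantorovich_Rubinstein_distance.

(** * Limits *)

Section regular_extension.
Context {R : realType} {X : metricType R}.
Variables (C : R) (lam : set X -> R).
Hypothesis lam_ge0 : forall K, 0 <= lam K.
Hypothesis lam_le_bound : forall K, lam K <= C.
Hypothesis lam_outer : forall K e, compact K -> 0 < e ->
  exists U, [/\ open U, K `<=` U &
    forall L, compact L -> L `<=` U -> lam L <= lam K + e].
Hypothesis lam_additive : forall K L, compact K -> compact L ->
  K `&` L = set0 -> lam (K `|` L) = lam K + lam L.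
Local Open Scope ereal_scope.

(** Open sets get the supremum of [lam] over their compact subsets, closed sets the infimum over
    their open neighborhoods. By [lam_outer] this returns [lam] on compact sets, so additivity is
    inherited. *)
Lemma regular_extension : exists2 mu,
  variation_ball deficient_topological_measure C mu &
  forall K, compact K -> mu K = (lam K)%:E.
Proof.
pose o U := ereal_sup [set (lam K)%:E | K in [set K | compact K /\ K `<=` U]].
pose hull A := [set o U | U in [set U | open U /\ A `<=` U]].
(* One formula serves open and closed sets: an open set is its own smallest open neighborhood, so
   the infimum there is [o A]. *)
pose mu A := if pselect (open A \/ closed A) then ereal_inf (hull A) else 0.
have o_le U V : U `<=` V -> o U <= o V.
  move=> UV; apply: ereal_sup_le => _ [K [cK KU] <-]; exists K => //.
  by split=> //; exact: subset_trans UV.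
have o_ge0 U : 0 <= o U.
  apply: le_ereal_sup_tmp; exists (lam set0)%:E; last by rewrite lee_fin.
  by exists set0 => //; split=> //; exact: compact0.
have muE A : open A \/ closed A -> mu A = ereal_inf (hull A).
  by rewrite /mu; case: pselect.
have muO U : open U -> mu U = o U.
  move=> oU; rewrite muE; last by left.
  apply/eqP; rewrite eq_le; apply/andP; split.
    by apply: ereal_inf_lbound; exists U => //; split.
  by apply: le_ereal_inf_tmp => _ [V [oV UV] <-]; exact: o_le.
have muK K : compact K -> mu K = (lam K)%:E.
  move=> cK; rewrite muE; last by right; exact: compact_closed_metric.
  apply/eqP; rewrite eq_le; apply/andP; split.
    apply/lee_addgt0Pr => e e0; have [U [oU KU Ule]] := lam_outer cK e0.
    apply: (@le_trans _ _ (o U)); first by apply: ereal_inf_lbound; exists U.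
    by apply: ge_ereal_sup => _ [L [cL LU] <-]; rewrite -EFinD lee_fin; exact: Ule.
  apply: le_ereal_inf_tmp => _ [U [oU KU] <-].
  by apply: ereal_sup_ubound; exists K.
have muX : mu setT <= C%:E.
  rewrite (muO _ openT); apply: ge_ereal_sup => _ [K _ <-].
  by rewrite lee_fin.
exists mu => //; split=> //; split.
- by move=> A oA cA; rewrite /mu; case: pselect => // oc; case: oc.
- move=> A; rewrite /mu; case: pselect => // oc.
  by apply: le_ereal_inf_tmp => _ [U _ <-].
- exists setT; first by left; exact: openT.
  by rewrite lt_eqF// (le_lt_trans muX)// ltry.
- move=> A B /= cA cB cAB AB0; rewrite !muK//.
  by rewrite lam_additive.
- move=> U oU; rewrite muO//; congr ereal_sup.
  by apply/seteqP; split=> _ [K [cK KU] <-]; exists K; rewrite // muK.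
- move=> F cF; rewrite muE; last by right.
  congr ereal_inf.
  by apply/seteqP; split=> _ [U [oU FU] <-]; exists U; rewrite // muO.
Qed.

End regular_extension.

(** * Limits of Cauchy sequences of deficient topological measures *)

Section limits.
Context {R : realType} {X : metricType R}.
Implicit Types (f g : X -> R) (K U V : set X) (mu nu : set X -> \bar R).
Hypothesis X_locally_compact : locally_compact [set: X].
Hypothesis X_bounded : exists D : R, forall x y : X, mdist x y <= D.
Variable C : R.
Notation ball := (variation_ball deficient_topological_measure C).

Lemma dKR_nonnegP mu nu (d : R) : ball mu -> ball nu ->
  (dKR_nonneg mu nu <= d%:E)%E <->
  forall f, Lip1_ge0 f -> `|qint mu f - qint nu f| <= d.
Proof. by move=> bmu bnu; apply: (dKR_overP X_bounded _ _ bmu bnu) => f [[]]. Qed.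

(** Tests the distance on a bump. Since [e] and [V] depend on [K] and [U] only, the estimate is
    uniform over the ball. *)
Lemma mass_le_dKR_nonneg K U : compact K -> open U -> K `<=` U ->
  exists (e : R) V, [/\ 0 < e, open V, K `<=` V &
    forall mu nu d, ball mu -> ball nu -> (dKR_nonneg mu nu <= d%:E)%E ->
      e * mass mu V <= e * mass nu U + d].
Proof.
move=> cK oU KU.
have [e [g [V [e0 Tg [oV KV] [Ve ge] gU]]]] :=
  lipschitz_urysohn X_locally_compact cK oU KU.
exists e, V; split=> // mu nu d bmu bnu /(dKR_nonnegP _ bmu bnu)/(_ g Tg).
have g0e x : 0 <= g x <= e by rewrite ge andbT; exact: Tg.2.
have := qint_ge bmu Tg.1.1.1 (ltW e0) g0e Ve.
have := qint_le bnu Tg.1.1.1 (ltW e0) g0e oU gU.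
by rewrite ler_norml => ? ? /andP[_]; lra.
Qed.

Lemma dKR_nonneg_eq0 mu nu : ball mu -> ball nu ->
  dKR_nonneg mu nu = 0%E -> mu = nu.
Proof.
have H rho sigma K U : ball rho -> ball sigma -> dKR_nonneg rho sigma = 0%E ->
    compact K -> open U -> K `<=` U -> (rho K <= sigma U)%E.
  move=> br bs d0 cK oU KU.
  have [e [V [e0 oV KV rs]]] := mass_le_dKR_nonneg cK oU KU.
  rewrite (massE br) (massE bs) lee_fin.
  apply: (le_trans (mass_le br (or_introl oV) KV)).
  by rewrite -(ler_pM2l e0) -[leRHS]addr0; apply: rs => //; rewrite d0.
move=> bmu bnu d0; apply: (dtm_eq bmu.1 bnu.1) => K U; apply: H => //.
rewrite /dKR_nonneg (dKR_over_sym X_bounded _ bnu bmu)//.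
by move=> f [[]].
Qed.

(** A portmanteau-type form of weak convergence: masses are compared only between a compact set and
    an open neighborhood of it. *)
Definition setwise_limit (u : nat -> set X -> \bar R) mu :=
  (forall K e, compact K -> 0 < e -> exists U, [/\ open U, K `<=` U &
    \forall n \near \oo, mass (u n) U <= mass mu K + e]) /\
  (forall K U e, compact K -> open U -> K `<=` U -> 0 < e ->
    \forall n \near \oo, mass mu K <= mass (u n) U + e).

Section sequence.
Variable u : nat -> set X -> \bar R.
Hypothesis u_ball : forall n, ball (u n).

Lemma cauchy_setwise_limit : emetric_cauchy dKR_nonneg u ->
  exists2 mu, ball mu & setwise_limit u mu.
Proof.
move=> u_cauchy.
have key K U : compact K -> open U -> K `<=` U ->
    exists V, [/\ open V, K `<=` V & forall d, 0 < d -> exists N,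
      forall m n, (N <= m)%N -> (N <= n)%N -> mass (u m) V <= mass (u n) U + d].
  move=> cK oU KU; have [e [V [e0 oV KV uVU]]] := mass_le_dKR_nonneg cK oU KU.
  (* The tolerance [e * d] becomes [d] after division by the height [e] of the bump. *)
  exists V; split=> // d d0; have [N uN] := u_cauchy (e * d) (mulr_gt0 e0 d0).
  exists N => m n Nm Nn; rewrite -(ler_pM2l e0) mulrDr.
  by apply: uVU => //; exact/ltW/uN.
(* The eventual upper bounds of the masses of a neighborhood. Their infimum over all neighborhoods
   is the infimum of the upper limits. *)
pose S K := [set r : R | exists U, [/\ open U, K `<=` U &
  \forall n \near \oo, mass (u n) U <= r]].
pose lam K := inf (S K).
have S_C K : S K C.
  exists setT; split=> //; first exact: openT.
  by apply: nearW => n; exact: mass_bound (u_ball n) _.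
have S_lb K : lbound (S K) 0.
  move=> r [U [_ _ [N _ /(_ N (leqnn N))]]].
  exact: le_trans (mass_ge0 (u_ball N) U).
have S_inf K : has_inf (S K) by split; [exists C|exists 0].
have lam_ge0 K : 0 <= lam K by apply: lb_le_inf => //; exists C.
have lam_le K r U : open U -> K `<=` U ->
    (\forall n \near \oo, mass (u n) U <= r) -> lam K <= r.
  by move=> oU KU Ur; apply: ge_inf; [exists 0|exists U].
have lam_C K : lam K <= C by apply: ge_inf; [exists 0|].
have lam_out K e : 0 < e -> exists U, [/\ open U, K `<=` U &
    \forall n \near \oo, mass (u n) U <= lam K + e].
  move=> e0; have [r [U [oU KU Ur]] rK] := inf_adherent e0 (S_inf K).
  exists U; split=> //; apply: filterS Ur => n /le_trans; apply; exact: ltW.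
(* By [key] the mass of [U] at one late index bounds all late masses of [V] up to [e], hence also
   [lam K]; this is the lower-limit half. *)
have lam_in K U e : compact K -> open U -> K `<=` U -> 0 < e ->
    \forall n \near \oo, lam K <= mass (u n) U + e.
  move=> cK oU KU e0; have [V [oV KV VU]] := key K U cK oU KU.
  have [N uN] := VU e e0; exists N => // n /= Nn.
  by apply: (lam_le K _ V) => //; exists N => // m /= Nm; exact: uN.
have [| |mu bmu muE] := @regular_extension R X C lam lam_ge0 lam_C.
- move=> K e cK e0; have [U [oU KU Ue]] := lam_out K e e0.
  by exists U; split=> // L _ LU; exact: lam_le Ue.
- move=> K L cK cL KL0.
  (* Every neighborhood below is cut down to these fixed disjoint open sets, on which each [u n] is
     additive. Both inequalities for [lam] follow. *)
  have [U1 [V1 [oU1 oV1 KU1 LV1 UV0]]] := compact_sub_disjoint cK cL KL0.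
  have openD n U V : open U -> open V -> U `<=` U1 -> V `<=` V1 ->
      mass (u n) (U `|` V) = mass (u n) U + mass (u n) V.
    move=> oU oV UU1 VV1; apply: EFin_inj.
    rewrite EFinD -!(massE (u_ball n)).
    apply: (dtm_openU (u_ball n).1) => //; first exact: ball_finite (u_ball n).
    by rewrite -subset0 -UV0; exact: setISS.
  apply/eqP; rewrite eq_le; apply/andP; split; apply/ler_addgt0Pr => e e0;
      have e20 : 0 < e / 2 by rewrite divr_gt0.
    have [U [oU KU Ue]] := lam_out K _ e20.
    have [V [oV LV Ve]] := lam_out L _ e20.
    apply: (lam_le _ _ ((U `&` U1) `|` (V `&` V1))).
    - by apply: openU; exact: openI.
    - by apply: setUSS; rewrite subsetI.
    - apply: filterS2 Ue Ve => n Un Vn.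
      rewrite openD; [|exact: openI|exact: openI|by move=> x []|by move=> x []].
      have := mass_le (u_ball n) (or_introl oU) (@subIsetl _ U U1).
      have := mass_le (u_ball n) (or_introl oV) (@subIsetl _ V V1).
      by lra.
  have [W [oW KLW We]] := lam_out (K `|` L) _ e20.
  have e40 : 0 < e / 2 / 2 by rewrite divr_gt0.
  have oWU := openI oW oU1; have oWV := openI oW oV1.
  have KWU : K `<=` W `&` U1 by move=> x Kx; split; [apply: KLW; left|exact: KU1].
  have LWV : L `<=` W `&` V1 by move=> x Lx; split; [apply: KLW; right|exact: LV1].
  have Kn := lam_in _ _ _ cK oWU KWU e40.
  have Ln := lam_in _ _ _ cL oWV LWV e40.
  have [n [[Wn kn] ln]] := filter_ex (filterI (filterI We Kn) Ln).
  have := openD n _ _ oWU oWV (@subIsetr _ W U1) (@subIsetr _ W V1).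
  rewrite -setIUr.
  have := mass_le (u_ball n) (or_introl oW) (@subIsetl _ W (U1 `|` V1)).
  by move: Wn kn ln => /=; lra.
exists mu => //.
have massK K : compact K -> mass mu K = lam K by move=> cK; rewrite /mass muE.
split=> [K e cK e0|K U e cK oU KU e0]; rewrite massK//; first exact: lam_out.
exact: lam_in.
Qed.

Variable mu : set X -> \bar R.
Hypotheses (mu_ball : ball mu) (u_mu : setwise_limit u mu).

Lemma setwise_limit_qint f e : Lip1_ge0 f -> 0 < e ->
  \forall n \near \oo, `|qint (u n) f - qint mu f| <= e.
Proof.
move=> Tf e0; have cf := Tf.1.1.1.
have [B B0 fB] := Lip1_ge0_bound X_bounded Tf.
have cpt t : 0 < t -> compact (f @^-1` `[t, +oo[).
  move=> t0; apply: subclosed_compact Tf.1.2.2 _.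
    by apply: preimage_closed => [x _|]; [exact: cf|exact: interval_closed].
  move=> x /=; rewrite in_itv/= andbT => fx; apply: subset_closure => /=.
  by rewrite gt_eqF// (lt_le_trans t0).
have sub s t : s < t -> f @^-1` `[t, +oo[ `<=` f @^-1` `]s, +oo[.
  by move=> st x /=; rewrite !in_itv/= !andbT; exact: lt_le_trans.
have lt_sub t : f @^-1` `]t, +oo[ `<=` f @^-1` `[t, +oo[.
  by move=> x /=; rewrite !in_itv/= !andbT => /ltW.
(* For [s < t] the set {f >= t} lies between {f > t} and {f > s}. It is compact because [t > 0], so
   setwise convergence applies to it. *)
have upper s t d : 0 <= s -> s < t -> 0 < d ->
    \forall n \near \oo, profile (u n) f t <= profile mu f s + d.
  move=> s0 st d0; have ct := cpt t (le_lt_trans s0 st).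
  have [U [oU KU Ud]] := u_mu.1 _ _ ct d0.
  apply: filterS Ud => n un.
  apply: le_trans (mass_le (u_ball n) (or_introl oU) (subset_trans (lt_sub t) KU)) _.
  apply: (le_trans un); rewrite lerD2r; apply: (mass_le mu_ball); last exact: sub.
  by left; exact: open_superlevel.
have lower s t d : 0 <= s -> s < t -> 0 < d ->
    \forall n \near \oo, profile mu f t <= profile (u n) f s + d.
  move=> s0 st d0; have ct := cpt t (le_lt_trans s0 st).
  have := u_mu.2 _ _ _ ct (open_superlevel s cf) (sub s t st) d0.
  apply: filterS => n; apply: le_trans; apply: (mass_le mu_ball) => //.
  by right; exact: compact_closed_metric.
have nu_ n := profile_nonincreasing (u_ball n) cf.
have bu_ n := profile_bounds (u_ball n) f.
have nm (n : nat) := profile_nonincreasing mu_ball cf.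
have bm (n : nat) := profile_bounds mu_ball f.
have := area_le_near B0 nm nu_ bm bu_ lower e0.
have := area_le_near B0 nu_ nm bu_ bm upper e0.
apply: filterS2 => n; rewrite (qint_ge0E mu_ball cf (ltW B0) fB).
by rewrite (qint_ge0E (u_ball n) cf (ltW B0) fB) ler_norml => ? ?; apply/andP; split; lra.
Qed.

(** The threshold [N] comes from the Cauchy property alone, while the auxiliary index [m] may depend
    on [f]; this makes the convergence uniform in [f]. *)
Lemma setwise_limit_dKR_nonneg e : emetric_cauchy dKR_nonneg u -> 0 < e ->
  \forall n \near \oo, (dKR_nonneg (u n) mu <= e%:E)%E.
Proof.
move=> u_cauchy e0; have e20 : 0 < e / 2 by rewrite divr_gt0.
have [N uN] := u_cauchy _ e20; exists N => // n /= Nn.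
apply/(dKR_nonnegP _ (u_ball n) mu_ball) => f Tf.
have [m [Nm um]] := filter_ex (filterI (nbhs_infty_ge N) (setwise_limit_qint Tf e20)).
have /ltW/(dKR_nonnegP _ (u_ball n) (u_ball m))/(_ f Tf) := uN _ _ Nn Nm.
have := ler_distD (qint (u m) f) (qint (u n) f) (qint mu f).
by move: um => /=; lra.
Qed.

Lemma setwise_limit_topological_measure :
  (forall n, topological_measure (u n)) -> topological_measure mu.
Proof.
move=> uT; apply: (topological_measureP mu_ball.1 (ball_finite mu_ball)).
move=> K U cK oU KU.
have oUK : open (U `\` K).
  by apply: openI => //; exact: closed_openC (compact_closed_metric _).
apply: (dtm_inner mu_ball.1) => // L cL LU.
rewrite !(massE mu_ball) -EFinD lee_fin; apply/ler_addgt0Pr => e e0.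
have e30 : 0 < e / 3 by rewrite divr_gt0.
have [V [oV KV Ve]] := u_mu.1 _ _ cK e30.
(* The set [D] thickens [K] inside [V], and [E] thickens the union of [L] and [D] inside [U]. Each
   [u n] splits the interior of [E] into [D], controlled by [V], and the rest, controlled by a
   neighborhood [W] of the compact shell between [E] and the interior of [D]. Three errors of
   [e / 3] occur, for [V], [W] and [L]. *)
have [D [cD KD DUV]] := compact_sub_interior X_locally_compact cK (openI oU oV)
  (fun x Kx => conj (KU x Kx) (KV x Kx)).
have cLD := compactU cL cD.
have LDU : L `|` D `<=` U by rewrite subUset; split=> // x /DUV[].
have [E [cE LDE EU]] := compact_sub_interior X_locally_compact cLD oU LDU.
have cG : compact (E `&` ~` D°).
  by apply: compact_closedI => //; apply: open_closedC; exact: open_interior.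
have [W [oW GW We]] := u_mu.1 _ _ cG e30.
have GUK : E `&` ~` D° `<=` U `\` K.
  by move=> x [/EU Ux Dx]; split=> // /KD.
have oE : open E° by exact: open_interior.
have LE : L `<=` E° by move=> x Lx; apply: LDE; left.
have DE : D `<=` E° by move=> x Dx; apply: LDE; right.
have Ln := u_mu.2 _ _ _ cL oE LE e30.
have [n [[Vn Wn] ln]] := filter_ex (filterI (filterI Ve We) Ln).
have oED : open (E° `\` D).
  by apply: openI => //; exact: closed_openC (compact_closed_metric _).
have EE : E° = D `|` (E° `\` D) by rewrite setUDr setDv setD0; apply/esym/setUidPr.
have := set_map_additive (uT n) (A := D) (B := E° `\` D).
rewrite -EE => /(_ (or_introl cD) (or_intror oED) (or_intror oE)).
rewrite setDE setICA setICr setI0 => /(_ erefl).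
rewrite !(massE (u_ball n)) -setDE => -[Esplit].
have DV := mass_le (u_ball n) (or_introl oV) (fun x Dx => (DUV x Dx).2).
have EDW : mass (u n) (E° `\` D) <= mass (u n) W.
  apply: (mass_le (u_ball n)); first by left.
  move=> x [/interior_subset Ex Dx]; apply: GW; split=> // /interior_subset.
  exact: Dx.
have := mass_le mu_ball (or_introl oUK) GUK.
by move: Vn Wn ln => /=; lra.
Qed.

End sequence.
End limits.

(** * Metric axioms and completeness for both families *)

Lemma emetric_cvg_near (R : realType) (T : Type) (d : T -> T -> \bar R)
    (u : nat -> T) (x : T) : (forall n, 0 <= d (u n) x)%E ->
  (forall e : R, 0 < e -> \forall n \near \oo, (d (u n) x <= e%:E)%E) ->
  emetric_cvg d u x.
Proof.
move=> d0 dle; apply/fine_cvgP; split.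
  apply: filterS (dle 1 ltr01) => n dn.
  by rewrite ge0_fin_numE// (le_lt_trans dn)// ltry.
apply/cvgrPdist_le => e e0; apply: filterS (dle e e0) => n dn /=.
rewrite sub0r normrN ger0_norm ?fine_ge0// -lee_fin fineK//.
by rewrite ge0_fin_numE// (le_lt_trans dn)// ltry.
Qed.

Theorem theorem45 (R : realType) (X : metricType R)
    (X_locally_compact : locally_compact [set: X])
    (X_bounded : exists D : R, forall x y : X, mdist x y <= D)
    (C : R) (C_gt0 : 0 < C) (M : set (set X -> \bar R)) :
  (M `<=` variation_ball topological_measure C ->
    complete_metric_family dKR
      (variation_ball topological_measure C) M) /\
  (M `<=` variation_ball deficient_topological_measure C ->
    complete_metric_family dKR_nonneg
      (variation_ball deficient_topological_measure C) M).
Proof.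
have L1 : (Lip1 `&` Cc : set (X -> R)) `<=` Lip1 by move=> f [].
have L1p : (Lip1_ge0 : set (X -> R)) `<=` Lip1 by move=> f [[]].
have Tp0 : (Lip1_ge0 : set (X -> R)) !=set0 by exists (fun=> 0); exact: Lip1_Cc_cst0.
have T0 : (Lip1 `&` Cc : set (X -> R)) !=set0.
  by exists (fun=> 0); have [] := @Lip1_Cc_cst0 R X.
split=> MB.
- have MD mu : M mu -> variation_ball deficient_topological_measure C mu.
    by move=> /MB/variation_ballW.
  split.
  + split.
    * by move=> mu nu _ _; exact: dKR_over_ge0.
    * move=> mu nu Mmu Mnu; split=> [d0|<-].
        apply: (dKR_nonneg_eq0 X_locally_compact X_bounded (MD _ Mmu) (MD _ Mnu)).
        by apply/eqP; rewrite eq_le -{1}d0 dKR_nonneg_le_dKR dKR_over_ge0.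
      exact (dKR_over_refl X_bounded T0 L1 (MD _ Mmu)).
    * by move=> mu nu Mmu Mnu; exact (dKR_over_sym X_bounded L1 (MD _ Mmu) (MD _ Mnu)).
    * move=> mu nu rho Mmu Mnu Mrho.
      exact (dKR_over_triangle X_bounded L1 (MD _ Mmu) (MD _ Mnu) (MD _ Mrho)).
  + move=> mu nu Mmu Mnu mass_eq.
    apply: le_lt_trans (dKR_le_dKR_nonneg X_bounded (MB _ Mmu) (MB _ Mnu)) _.
    by rewrite lte_add_pinfty// (dKR_nonneg_finite X_bounded (MD _ Mmu) (MD _ Mnu)).
  + move=> Mclosed u Mu u_cauchy; have uD n := MD _ (Mu n).
    (* The smaller distance already yields a deficient limit, which is then shown to be a
       topological measure. *)
    have u_cauchyp : emetric_cauchy dKR_nonneg u.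
      move=> e e0; have [N uN] := u_cauchy e e0; exists N => m n Nm Nn.
      exact: le_lt_trans (dKR_nonneg_le_dKR _ _) (uN m n Nm Nn).
    have [mu muD u_mu] := cauchy_setwise_limit X_locally_compact X_bounded uD u_cauchyp.
    have muT : variation_ball topological_measure C mu.
      split; last exact: muD.2.
      apply: (setwise_limit_topological_measure X_locally_compact uD muD u_mu) => n.
      exact: (MB _ (Mu n)).1.
    have cvg_mu : emetric_cvg dKR u mu.
      apply: emetric_cvg_near => [n|e e0]; first exact: dKR_over_ge0.
      (* Half of [e] compensates the factor 2 between the two distances. *)
      have e20 : 0 < e / 2 by rewrite divr_gt0.
      apply: filterS (setwise_limit_dKR_nonneg X_bounded uD muD u_mu u_cauchyp e20).
      move=> n un; apply: le_trans (dKR_le_dKR_nonneg X_bounded (MB _ (Mu n)) muT) _.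
      by rewrite [e]splitr EFinD leeD.
    by exists mu => //; exact: Mclosed cvg_mu.
- split.
  + split.
    * by move=> mu nu _ _; exact: dKR_over_ge0.
    * move=> mu nu Mmu Mnu; split=> [|<-].
        exact: (dKR_nonneg_eq0 X_locally_compact X_bounded (MB _ Mmu) (MB _ Mnu)).
      exact (dKR_over_refl X_bounded Tp0 L1p (MB _ Mmu)).
    * by move=> mu nu Mmu Mnu; exact (dKR_over_sym X_bounded L1p (MB _ Mmu) (MB _ Mnu)).
    * move=> mu nu rho Mmu Mnu Mrho.
      exact (dKR_over_triangle X_bounded L1p (MB _ Mmu) (MB _ Mnu) (MB _ Mrho)).
  + by move=> mu nu Mmu Mnu; exact (dKR_nonneg_finite X_bounded (MB _ Mmu) (MB _ Mnu)).
  + move=> Mclosed u Mu u_cauchy; have uD n := MB _ (Mu n).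
    have [mu muD u_mu] := cauchy_setwise_limit X_locally_compact X_bounded uD u_cauchy.
    have cvg_mu : emetric_cvg dKR_nonneg u mu.
      apply: emetric_cvg_near => [n|e e0]; first exact: dKR_over_ge0.
      exact: (setwise_limit_dKR_nonneg X_bounded uD muD u_mu u_cauchy e0).
    by exists mu => //; exact: Mclosed cvg_mu.
Qed.
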